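(* Let $X$ be a (real) Banach space which is weak$^*$-sequentially dense in $X^{**}$. Then: (i) $\overline{C}^{w^*}=\overline{S_1(C)}^{\|\cdot\|}=S_2(C)$ for every convex bounded set $C\subseteq X^*$; (ii) $X$ has property $(\mathcal{E}')$; (iii) $X$ has property $(\mathcal{E})$ if and only if $X$ has property $(\mathcal{P})$.
   Context: All Banach spaces are real. $X^*$ and $X^{**}$ are the dual and bidual of $X$, and $w^*$ is the weak$^*$-topology of $X^*$. ''$X$ is weak$^*$-sequentially dense in $X^{**}$'' means that every element of $X^{**}$ is the limit, in the weak$^*$-topology $\sigma(X^{**},X^* )$, of a sequence of elements of (the canonical image of) $X$. For $D\subseteq X^*$, $S_1(D)\subseteq X^*$ is the set of all limits of weak$^*$-convergent sequences contained in $D$. For ordinals $\alpha\le\omega_1$, the sets $S_\alpha(D)$ are defined by transfinite induction: $S_0(D):=D$; $S_\alpha(D):=S_1(S_\beta(D))$ if $\alpha=\beta+1$; $S_\alpha(D):=\bigcup_{\beta<\alpha}S_\beta(D)$ if $\alpha$ is a limit ordinal. A Banach space $X$ has: - property $(\mathcal{E})$ if $S_1(C)=\overline{C}^{w^*}$ for every convex bounded set $C\subseteq X^*$ (i.e. every element of the weak$^*$-closure of $C$ is the weak$^*$-limit of a sequence in $C$); - property $(\mathcal{E}')$ if $S_{\omega_1}(C)=\overline{C}^{w^*}$ for every convex bounded set $C\subseteq X^*$ (equivalently, every weak$^*$-sequentially closed convex bounded subset of $X^*$ is weak$^*$-closed); - property $(\mathcal{P})$ if $S_1(C)$ is norm-closed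 for every convex bounded set $C\subseteq X^*$. *)

(* Defs.v *)
From HB Require Import structures.
From mathcomp Require Import all_boot all_order all_algebra.
From mathcomp Require Import wochoice.
From mathcomp Require Import all_classical all_reals all_analysis.
Set Implicit Arguments.
Unset Strict Implicit.
Unset Printing Implicit Defensive.
Import Order.TTheory GRing.Theory Num.Theory.
Import numFieldNormedType.Exports.
Local Open Scope classical_set_scope.
Local Open Scope ring_scope.

Section dual_lmodule.
Context (R : realType) (X : normedModType R).

Definition is_functional : {pred (X -> R^o)} :=
  mem [set f : X -> R^o | linear f /\ continuous f].

Record dual := Dual {
  dual_fun :> X -> R^o;
  dual_funP : dual_fun \in is_functional }.

HB.instance Definition _ := [isSub for dual_fun].
HB.instance Definition _ := [Choice of dual by <:].

Lemma is_functional_submod_closed : submod_closed is_functional.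
Proof.
split=> [|a f g]; rewrite !inE.
  by split=> [k x y|]; [rewrite scaler0 addr0|exact: cst_continuous].
move=> -[lf cf] [lg cg]; split=> [k x y|].
  rewrite -[LHS]/(a *: f (k *: x + y) + g (k *: x + y)) lf lg.
  rewrite -[RHS]/(k *: (a *: f x + g x) + (a *: f y + g y)).
  by rewrite !scalerDr !scalerA mulrC addrACA.
rewrite -[a *: f + g]/(fun z => a *: f z + g z) => x.
by apply: cvgD; [apply: cvgZr; exact: cf|exact: cg].
Qed.

HB.instance Definition _ :=
  GRing.isSubmodClosed.Build R (X -> R^o) is_functional
    is_functional_submod_closed.
HB.instance Definition _ := [SubChoice_isSubLmodule of dual by <:].

Lemma dual_linear (f : dual) : linear f.
Proof. by have := dual_funP f; rewrite inE => -[]. Qed.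

HB.instance Definition _ (f : dual) :=
  GRing.isLinear.Build R X R^o _ f (dual_linear f).

Lemma dual_continuous (f : dual) : continuous f.
Proof. by have := dual_funP f; rewrite inE => -[]. Qed.

Lemma dual_eq (f g : dual) : (forall x, f x = g x) -> f = g.
Proof. by move=> fg; apply: val_inj; apply/funext. Qed.

Lemma dualDE (f g : dual) x : (f + g) x = f x + g x.
Proof. by []. Qed.

Lemma dualZE a (f : dual) x : (a *: f) x = a *: f x.
Proof. by []. Qed.

Definition dual_norm (f : dual) : R :=
  sup [set `|f x| | x in [set x : X | `|x| <= 1]].

Lemma dual_norm_has_sup (f : dual) :
  has_sup [set `|f x| | x in [set x : X | `|x| <= 1]].
Proof.
split; first by exists `|f 0|; exists 0 => //=; rewrite normr0.
have /bounded_funP /(_ 1) [M HM] :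
    bounded_near (f : {linear X -> R^o}) (nbhs (0 : X)).
  by apply/linear_bounded_continuous; exact: dual_continuous.
by exists M => _ [x /= x1 <-]; exact: HM.
Qed.

Lemma dual_norm_le (f : dual) (M : R) :
  (forall x : X, `|x| <= 1 -> `|f x| <= M) -> dual_norm f <= M.
Proof.
move=> HM; apply: ge_sup; first by case: (dual_norm_has_sup f).
by move=> _ [x /= x1 <-]; exact: HM.
Qed.

Lemma dual_norm_ball (f : dual) (x : X) : `|x| <= 1 -> `|f x| <= dual_norm f.
Proof.
move=> x1; apply: ub_le_sup; first by case: (dual_norm_has_sup f).
by exists x.
Qed.

Lemma dual_norm_ge0 (f : dual) : 0 <= dual_norm f.
Proof. by apply: le_trans (@dual_norm_ball f 0 _); rewrite ?normr0. Qed.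

Lemma dual_norm_bound (f : dual) (x : X) : `|f x| <= dual_norm f * `|x|.
Proof.
have [->|x0] := eqVneq x 0; first by rewrite raddf0 !normr0 mulr0.
have nx : 0 < `|x| by rewrite normr_gt0.
rewrite -ler_pdivrMr// mulrC.
have -> : `|x|^-1 * `|f x| = `|f (`|x|^-1 *: x)|.
  by rewrite linearZ normrZ ger0_norm// invr_ge0.
apply: dual_norm_ball; rewrite normrZ ger0_norm ?invr_ge0//.
by rewrite mulVf// gt_eqF.
Qed.

Lemma dual_normD (f g : dual) : dual_norm (f + g) <= dual_norm f + dual_norm g.
Proof.
apply: dual_norm_le => x x1; rewrite dualDE (le_trans (ler_normD _ _))//.
by rewrite lerD// dual_norm_ball.
Qed.

Lemma dual_normZ (a : R) (f : dual) : dual_norm (a *: f) = `|a| * dual_norm f.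
Proof.
have leZ b g : dual_norm (b *: g) <= `|b| * dual_norm g.
  apply: dual_norm_le => x x1; rewrite dualZE normrZ ler_wpM2l//.
  exact: dual_norm_ball.
apply/eqP; rewrite eq_le leZ /=.
have [->|a0] := eqVneq a 0; first by rewrite normr0 mul0r dual_norm_ge0.
rewrite -ler_pdivlMl ?normr_gt0// -normfV.
by rewrite -{1}[f](scalerK a0) leZ.
Qed.

Lemma dual_norm0_eq0 (f : dual) : dual_norm f = 0 -> f = 0.
Proof.
move=> f0; apply: dual_eq => x; apply/eqP; rewrite -normr_le0.
by rewrite (le_trans (dual_norm_bound f x))// f0 mul0r.
Qed.

HB.instance Definition _ :=
  Lmodule_isNormed.Build R dual dual_normD dual_normZ dual_norm0_eq0.

End dual_lmodule.

Section evaluation.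
Context (R : realType) (X : normedModType R).

Lemma evaluation_functional (x : X) :
  (fun f : dual X => f x) \in @is_functional R (dual X).
Proof.
have lev : linear (fun f : dual X => (f x : R^o)) by [].
rewrite inE; split=> //.
pose ev := HB.pack_for {linear dual X -> R^o} (fun f : dual X => (f x : R^o))
  (GRing.isLinear.Build R (dual X) R^o _ _ lev).
apply: (@bounded_linear_continuous R (dual X) R^o ev).
apply/bounded_funP => r; exists (r * `|x|) => f fr.
by rewrite (le_trans (dual_norm_bound f x))// ler_wpM2r.
Qed.

Definition bidual_embed (x : X) : dual (dual X) :=
  Dual (evaluation_functional x).

End evaluation.

Definition set_nat_le : rel (set nat) :=
  sval (well_ordering_principle (set nat : eqType)).

Lemma set_nat_le_wo : well_order set_nat_le.
Proof. exact: svalP. Qed.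

(* In a well-ordering of an uncountable set, the elements with countably many
   predecessors form an initial segment of order type omega_1 (see
   [countable_ordinal_uncountable] and [countable_initial_segment] below).  Such
   an element stands for the order type of its predecessors, so that this type
   is the set of all countable ordinals. *)
Definition countable_ordinal : Type :=
  {x : set nat | countable [set y | set_nat_le y x]}.

Definition countable_ordinal_lt (a b : countable_ordinal) : Prop :=
  set_nat_le (sval a) (sval b) /\ sval a <> sval b.

(* The ordinals [<= omega_1]; [None] is [omega_1] itself. *)
Definition ordinal_le_omega1 : Type := option countable_ordinal.

Definition omega1 : ordinal_le_omega1 := None.

Definition ord_lt (a b : ordinal_le_omega1) : Prop :=
  match a, b with
  | Some x, Some y => countable_ordinal_lt x y
  | Some _, None => True
  | None, _ => False
  end.

Definition is_ord_zero (a : ordinal_le_omega1) : Prop := forall b, ~ ord_lt b a.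

Definition is_ord_succ (b a : ordinal_le_omega1) : Prop :=
  forall c, ord_lt c a <-> ord_lt c b \/ c = b.

Definition is_ord_limit (a : ordinal_le_omega1) : Prop :=
  ~ is_ord_zero a /\ ~ exists b, is_ord_succ b a.

(* [xget] picks the unique element of the given set; the default value is never
   used for the finite ordinals. *)
Definition ord_zero : ordinal_le_omega1 := xget omega1 is_ord_zero.
Definition ord_succ (a : ordinal_le_omega1) : ordinal_le_omega1 :=
  xget omega1 (is_ord_succ a).
Definition ord_of_nat (n : nat) : ordinal_le_omega1 := iter n ord_succ ord_zero.

Section set_nat_order.

Lemma countable_setU T (A B : set T) :
  countable A -> countable B -> countable (A `|` B).
Proof.
move=> cA cB; rewrite -bigcup2E; apply: bigcup_countable => // -[|[|n]] _ //=.
Qed.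

Lemma set_nat_le_total x y : set_nat_le x y || set_nat_le y x.
Proof.
have /wo_chainW ch : wo_chain set_nat_le predT.
  by move=> A _; exact: set_nat_le_wo.
exact: ch.
Qed.

Lemma set_nat_le_refl x : set_nat_le x x.
Proof. by have := set_nat_le_total x x; rewrite orbb. Qed.

Lemma set_nat_le_anti x y : set_nat_le x y -> set_nat_le y x -> x = y.
Proof.
have ch : wo_chain set_nat_le predT by move=> A _; exact: set_nat_le_wo.
move=> xy yx; apply: (wo_chain_antisymmetric ch) => //.
by rewrite xy yx.
Qed.

Lemma set_nat_le_min (A : set (set nat)) : A !=set0 ->
  exists2 z, A z & forall x, A x -> set_nat_le z x.
Proof.
move=> [x Ax]; have [|z [[zA zmin] _]] := @set_nat_le_wo [pred y | y \in A].
  by exists x; rewrite !inE.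
exists z; first by move: zA; rewrite !inE.
by move=> y Ay; apply: zmin; rewrite !inE.
Qed.

Lemma set_nat_le_trans y x z :
  set_nat_le x y -> set_nat_le y z -> set_nat_le x z.
Proof.
move=> xy yz.
have [|m + mmin] := @set_nat_le_min [set t | t = x \/ t = y \/ t = z].
  by exists x; left.
have mx := mmin x (or_introl erefl).
have my := mmin y (or_intror (or_introl erefl)).
have mz := mmin z (or_intror (or_intror erefl)).
move=> [? | [? | ?]]; subst m => //.
- by rewrite (set_nat_le_anti xy mx).
- by rewrite (set_nat_le_anti my yz).
Qed.

End set_nat_order.

Section ordinal_lemmas.
Implicit Types a b c : ordinal_le_omega1.

Lemma countable_ordinal_eq (a b : countable_ordinal) : sval a = sval b -> a = b.
Proof. exact: val_inj. Qed.

Lemma ord_lt_irr a : ~ ord_lt a a.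
Proof. by case: a => [a|] //= -[]. Qed.

Lemma ord_lt_trans b a c : ord_lt a b -> ord_lt b c -> ord_lt a c.
Proof.
case: a b c => [a|] [b|] [c|] //= [ab nab] [bc nbc]; split.
  exact: set_nat_le_trans bc.
by move=> ac; apply: nab; apply: set_nat_le_anti => //; rewrite ac.
Qed.

Lemma ord_lt_total a b : [\/ ord_lt a b, a = b | ord_lt b a].
Proof.
case: a b => [a|] [b|] /=; [|by constructor 1|by constructor 3|by constructor 2].
have [/countable_ordinal_eq->|nab] := pselect (sval a = sval b).
  by constructor 2.
have /orP[ab|ba] := set_nat_le_total (sval a) (sval b).
  by constructor 1.
by constructor 3; split=> // /esym.
Qed.

Lemma ord_lt_wf : well_founded ord_lt.
Proof.
have wfS (x : countable_ordinal) : Acc ord_lt (Some x).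
  apply: contrapT => nx.
  have [|z [zc nz] zmin] := @set_nat_le_min [set y | exists cy :
      countable [set t | set_nat_le t y], ~ Acc ord_lt (Some (exist _ y cy))].
    by case: x nx => x cx nx; exists x, cx.
  apply: nz; constructor => -[[y cy]|//] /= [/= yz nyz].
  apply: contrapT => ny; apply: nyz; apply: set_nat_le_anti => //.
  by apply: zmin; exists cy.
by case=> [x|]; [|constructor => -[x|]].
Qed.

Lemma ord_min (A : set ordinal_le_omega1) : A !=set0 ->
  exists2 a, A a & forall b, A b -> a = b \/ ord_lt a b.
Proof.
move=> [a Aa]; apply: contrapT => nmin.
suff nA b : ~ A b by exact: nA Aa.
elim/(well_founded_induction ord_lt_wf): b => b IHb Ab; apply: nmin.
exists b => // c Ac; have [||cb] := ord_lt_total b c; [by right|by left|].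
by case: (IHb c).
Qed.

Lemma is_ord_zero_uniq a b : is_ord_zero a -> is_ord_zero b -> a = b.
Proof.
by move=> a0 b0; have [ab||ba] := ord_lt_total a b => //; case: (b0 a, a0 b).
Qed.

Lemma is_ord_succ_inj b c a : is_ord_succ b a -> is_ord_succ c a -> b = c.
Proof.
move=> ba ca; have /ca[bc|//] : ord_lt b a by apply/ba; right.
have /ba[cb|//] : ord_lt c a by apply/ca; right.
by case: (@ord_lt_irr b); exact: ord_lt_trans cb.
Qed.

Lemma is_ord_succ_uniq b a c : is_ord_succ b a -> is_ord_succ b c -> a = c.
Proof.
move=> ba bc; have [ac||ca] := ord_lt_total a c => //.
  by have /ord_lt_irr : ord_lt a a by apply/ba/bc.
by have /ord_lt_irr : ord_lt c c by apply/bc/ba.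
Qed.

Lemma is_ord_succ_ex b a : ord_lt b a -> exists c, is_ord_succ b c.
Proof.
move=> ba; have [|c bc cmin] := @ord_min [set c | ord_lt b c]; first by exists a.
exists c => d; split=> [dc|[db|->//]]; last exact: ord_lt_trans bc.
have [||bd] := ord_lt_total d b; [by left|by right|].
have [cd|cd] := cmin _ bd; first by move: dc; rewrite cd => /ord_lt_irr.
by have /ord_lt_irr := ord_lt_trans dc cd.
Qed.

Lemma countable_initial_segment (x : countable_ordinal) :
  countable [set y | countable_ordinal_lt y x].
Proof.
have /countable_injP[f fi] : countable [set y | set_nat_le y (sval x)].
  by case: x.
apply/countable_injP; exists (f \o sval) => y z; rewrite !inE /= => -[yx _] [zx _].
by move=> /fi fyz; apply: countable_ordinal_eq; apply: fyz; rewrite inE.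
Qed.

Lemma countable_ordinal_uncountable : ~~ countable [set: countable_ordinal].
Proof.
apply/negP => cT.
pose B := [set x : set nat | countable [set y | set_nat_le y x]].
have cB : countable B.
  have -> : B = [set sval z | z in [set: countable_ordinal]].
    apply/seteqP; split=> [x Bx|_ [[x cx] _ <-]//].
    by exists (exist _ x Bx).
  exact: sub_countable (card_image_le _ _) cT.
have BT : B = setT.
  apply/seteqP; split=> // x _; apply: contrapT => nBx.
  have [|z nBz zmin] := @set_nat_le_min (~` B); first by exists x.
  apply: nBz; apply: (@sub_countable _ _ _ (B `|` [set z])).
    apply: subset_card_le => y /= yz.
    have [By|nBy] := pselect (B y); [by left|right].
    by apply: set_nat_le_anti => //; exact: zmin.
  exact: countable_setU.
move: cB; rewrite BT => /countable_injP[f fi].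
pose D := [set n | exists A : set nat, f A = n /\ ~ A n].
have [DfD|nDfD] := pselect (D (f D)); last by apply: (nDfD); exists D.
by have [A [fA nA]] := DfD; apply: nA; rewrite (fi A D) ?inE.
Qed.

Lemma omega1_limit : is_ord_limit omega1.
Proof.
split=> [nz|[[b|] sb]]; last exact: ((sb omega1).2 (or_intror erefl)).
  have /negP[] := countable_ordinal_uncountable.
  rewrite (_ : setT = set0) ?countable0//.
  by apply/seteqP; split=> // x _; exact: (nz (Some x)).
have /negP[] := countable_ordinal_uncountable.
rewrite (_ : setT = [set y | countable_ordinal_lt y b] `|` [set b]).
  exact: countable_setU (countable_initial_segment b) (countable1 b).
apply/seteqP; split=> // x _.
have /sb[xb|[->]] : ord_lt (Some x) omega1 by []; [by left|by right].
Qed.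

Lemma ord_zeroP : is_ord_zero ord_zero.
Proof.
apply: (@xgetPex _ omega1 is_ord_zero).
have [|a _ amin] := @ord_min setT; first by exists omega1.
exists a => b ba; have [ab|ab] := amin b I.
  by move: ba; rewrite ab => /ord_lt_irr.
by have /ord_lt_irr := ord_lt_trans ab ba.
Qed.

Lemma ord_succP a : ord_lt a omega1 -> is_ord_succ a (ord_succ a).
Proof. by move=> /is_ord_succ_ex; exact: xgetPex. Qed.

Lemma ord_of_nat_lt n : ord_lt (ord_of_nat n) omega1.
Proof.
suff nO : ord_of_nat n <> omega1 by case: (ord_of_nat n) nO.
elim: n => [n0|n IHn nS].
  by case: omega1_limit => nz _; apply: nz; rewrite -n0; exact: ord_zeroP.
case: omega1_limit => _; apply; exists (ord_of_nat n).
rewrite -nS; apply: ord_succP.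
by case: (ord_of_nat n) IHn.
Qed.

Lemma ord_of_natS n : is_ord_succ (ord_of_nat n) (ord_of_nat n.+1).
Proof. exact/ord_succP/ord_of_nat_lt. Qed.

End ordinal_lemmas.

Section weak_star.
Context (R : realType) (X : normedModType R).

(* The coarsest topology on [dual X] for which every evaluation at a point of
   [X] is continuous. *)
Definition weak_star : Type :=
  initial_topology (fun f : dual X => (f : {ptws X -> R^o})).
HB.instance Definition _ := Topological.on weak_star.

Definition weak_star_closure (C : set (dual X)) : set (dual X) :=
  closure (C : set weak_star).

Definition weak_star_cvg (u : nat -> dual X) (f : dual X) : Prop :=
  (u : nat -> weak_star) @ \oo --> (f : weak_star).

Lemma weak_star_cvgP (u : nat -> dual X) (f : dual X) :
  weak_star_cvg u f <-> forall x : X, u n x @[n --> \oo] --> f x.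
Proof.
pose e (g : dual X) : {ptws X -> R^o} := g.
split=> [ucv|ucv].
  have : (fun n => e (u n)) @ \oo --> e f.
    by apply: (cvg_comp _ _ ucv); exact: (@initial_continuous _ _ e).
  by move/pointwise_cvgP => + x => /(_ x).
have {}ucv : (fun n => e (u n)) @ \oo --> e f by apply/pointwise_cvgP.
move=> A /=; rewrite nbhsE => -[B [[B' oB' <-] B'f] BA].
have uB : \forall n \near \oo, B' (e (u n)).
  exact: ucv B' (open_nbhs_nbhs (conj oB' B'f)).
by apply: filterS uB => n; exact: BA.
Qed.

Definition S1 (D : set (dual X)) : set (dual X) :=
  [set f | exists u : nat -> dual X, (forall n, D (u n)) /\ weak_star_cvg u f].

(* The transfinite derived sets; the recursion equations are [S_zero], [S_succ]
   and [S_limit] below. *)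
Definition S_alpha (D : set (dual X)) : ordinal_le_omega1 -> set (dual X) :=
  Fix ord_lt_wf (fun=> set (dual X)) (fun a S_lt =>
    [set f | [\/ is_ord_zero a /\ D f,
      exists b (ba : ord_lt b a), is_ord_succ b a /\ S1 (S_lt b ba) f |
      is_ord_limit a /\ exists b (ba : ord_lt b a), S_lt b ba f]]).

Lemma S_alphaE D a : S_alpha D a =
    [set f | [\/ is_ord_zero a /\ D f,
      exists b, ord_lt b a /\ is_ord_succ b a /\ S1 (S_alpha D b) f |
      is_ord_limit a /\ exists b, ord_lt b a /\ S_alpha D b f]].
Proof.
rewrite {1}/S_alpha Fix_eq; last first.
  move=> b g h gh; suff -> : g = h by [].
  by apply: functional_extensionality_dep => c; apply/funext => cb.
apply/seteqP; split=> f /=.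
  by move=> [|[b [ba]]|[la [b [ba]]]]; [constructor 1|constructor 2; exists b|
    constructor 3; split=> //; exists b].
by move=> [|[b [ba]]|[la [b [ba]]]]; [constructor 1|constructor 2; exists b, ba|
  constructor 3; split=> //; exists b, ba].
Qed.

Lemma S_zero D : S_alpha D ord_zero = D.
Proof.
rewrite S_alphaE; apply/seteqP; split=> f /=.
  by case=> [[]//|[b [/ord_zeroP]]//|[[+ _] _]]; case; exact: ord_zeroP.
by constructor 1; split=> //; exact: ord_zeroP.
Qed.

Lemma S_succ D a b : is_ord_succ b a -> S_alpha D a = S1 (S_alpha D b).
Proof.
move=> sba; have ba : ord_lt b a by apply/sba; right.
rewrite S_alphaE; apply/seteqP; split=> f /=; last by constructor 2; exists b.
case=> [[/(_ b)//]|[c [_ [sca]]]|[[_ nsa] _]]; last by case: nsa; exists b.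
by rewrite (is_ord_succ_inj sca sba).
Qed.

Lemma S_limit D a : is_ord_limit a ->
  S_alpha D a = \bigcup_(b in [set b | ord_lt b a]) S_alpha D b.
Proof.
move=> la; rewrite S_alphaE; apply/seteqP; split=> f /=.
  move=> [[]|[b [_ [sba]]]|[_ [b [ba]]]]; last by exists b.
    by case: la => n0 _ /n0.
  by case: la => _; case; exists b.
by move=> [b ba fb]; constructor 3; split => //; exists b.
Qed.

Lemma S_two D : S_alpha D (ord_of_nat 2) = S1 (S1 D).
Proof.
by rewrite (S_succ _ (ord_of_natS 1)) (S_succ _ (ord_of_natS 0)) S_zero.
Qed.

End weak_star.

Section properties.
Context (R : realType) (X : completeNormedModType R).

Definition weak_star_seq_dense_in_bidual : Prop :=
  S1 (range (@bidual_embed R X)) = [set: dual (dual X)].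

Definition propertyE : Prop := forall C : set (dual X),
  convex_set C -> bounded_set C -> S1 C = weak_star_closure C.

Definition propertyE' : Prop := forall C : set (dual X),
  convex_set C -> bounded_set C -> S_alpha C omega1 = weak_star_closure C.

(* [closed] refers to the norm topology of [dual X]. *)
Definition propertyP : Prop := forall C : set (dual X),
  convex_set C -> bounded_set C -> closed (S1 C).

End properties.

(* Main.v *)
(* Let C be convex and bounded and suppose that some f in its weak* closure is
   not in the norm closure of S_1(C).  Separate f from S_1(C) by phi in X^** and
   let x_n in X tend weak* to phi.  The sets D_n of those g in C that are
   1/(n+1)-close to f at the first n points x_i form a decreasing sequence of
   nonempty convex sets.  It suffices to find a weak* convergent sequence with
   g_n in D_n: its limit is in S_1(C) and agrees with f on every x_n, so under
   phi, which is absurd.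

   To find it, shrink (D_n) to convex D'_n whose oscillation
     sup_(|x| <= 1) lim_n diam { g x : g in D'_n }
   cannot be lowered by shrinking further (diagonal argument).  If that minimal
   value is 0, any choice of g_n in D'_n converges pointwise.  If it is d > 0,
   then for finitely many shrinkings of (D'_n) the minimality of their average
   yields one x in the unit ball at which they all nearly attain both extreme
   values of D'; splitting repeatedly gives points x_n in the unit ball and
   levels a_n >= b_n + d/2 such that the half-spaces [g x_n >= a_n] and
   [g x_n <= b_n] are independent on C.
   Then no ultrafilter limit of the x_n in X^** is a pointwise limit of a
   sequence of X, by the Baire category theorem on the Cantor set of choices of
   sides, and this contradicts the density of X in X^**. *)
Require Import Defs.
From HB Require Import structures.
From mathcomp Require Import all_boot all_order all_algebra.
From mathcomp Require Import all_classical all_reals all_analysis.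
From mathcomp Require Import ring lra.
Set Implicit Arguments.
Unset Strict Implicit.
Unset Printing Implicit Defensive.
Import Order.TTheory GRing.Theory Num.Theory.
Import numFieldNormedType.Exports.
Local Open Scope classical_set_scope.
Local Open Scope ring_scope.

(** * The Hahn-Banach theorem *)

Section hahn_banach.
Context (R : realType) (V : lmodType R).

Definition sublinear (p : V -> R) :=
  (forall u v, p (u + v) <= p u + p v) /\
  (forall t v, 0 < t -> p (t *: v) <= t * p v).

Lemma sublinear0 p : sublinear p -> p 0 = 0.
Proof.
move=> [pD pZ]; apply/eqP; rewrite eq_le; apply/andP; split.
  by have := pZ 2^-1 0 ltac:(lra); rewrite scaler0; lra.
by have := pD 0 0; rewrite addr0; lra.
Qed.

Lemma sublinearN p v : sublinear p -> - p (- v) <= p v.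
Proof.
by move=> sp; have := sp.1 v (- v); rewrite subrr (sublinear0 sp); lra.
Qed.

Lemma sublinearZ p t v : sublinear p -> 0 < t -> p (t *: v) = t * p v.
Proof.
move=> sp t0; apply/eqP; rewrite eq_le sp.2//=.
have := sp.2 t^-1 (t *: v); rewrite invr_gt0 => /(_ t0).
by rewrite scalerA mulVf ?gt_eqF// scale1r ler_pdivlMl.
Qed.

Lemma sublinear_additive_linear p : sublinear p ->
  (forall u v, p u + p v <= p (u + v)) -> linear (p : V -> R^o).
Proof.
move=> sp pD'.
have pD u v : p (u + v) = p u + p v by apply/eqP; rewrite eq_le sp.1 pD'.
have pN v : p (- v) = - p v.
  by have := pD v (- v); rewrite subrr (sublinear0 sp); lra.
move=> k u v; rewrite pD; congr (_ + _).
have [k0|k0|<-] := ltgtP 0 k; first exact: sublinearZ.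
  rewrite -[k]opprK scaleNr pN sublinearZ ?oppr_gt0//.
  by rewrite scaleNr.
by rewrite !scale0r (sublinear0 sp).
Qed.

(** Take for [q v] the infimum of [p (v + t *: y) - t * p y] over [t >= 0], which subadditivity
    bounds below by [- p (- v)]. The choices [t = 0] and [t = 1] give the two inequalities. *)
Lemma sublinear_shift p y : sublinear p ->
  exists2 q, sublinear q &
    (forall v, q v <= p v) /\ (forall v, q v <= p (v + y) - p y).
Proof.
move=> sp.
pose A v := [set p (v + t *: y) - t * p y | t in [set t | 0 <= t]].
have Alb v : lbound (A v) (- p (- v)).
  move=> _ [t /= t0 <-].
  have pty : p (t *: y) = t * p y.
    move: t0; rewrite le_eqVlt => /orP[/eqP<-|t0]; last exact: sublinearZ.
    by rewrite scale0r mul0r sublinear0.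
  by have := sp.1 (v + t *: y) (- v); rewrite addrC addKr pty; lra.
have Ainf v : has_inf (A v).
  split; last by exists (- p (- v)).
  by exists (p v), 0 => //=; rewrite scale0r addr0 mul0r subr0.
have Ale v t : 0 <= t -> inf (A v) <= p (v + t *: y) - t * p y.
  by move=> t0; apply: ge_inf; [case: (Ainf v)|exists t].
have Alt v e : 0 < e ->
    exists2 t, 0 <= t & p (v + t *: y) - t * p y < inf (A v) + e.
  by move=> e0; have [_ [t /= t0 <-] h] := inf_adherent e0 (Ainf v); exists t.
exists (fun v => inf (A v)); split.
- move=> u v; apply/ler_addgt0Pr => e e0.
  have [s s0 hs] := Alt u (e / 2) ltac:(lra).
  have [t t0 ht] := Alt v (e / 2) ltac:(lra).
  have := Ale (u + v) (s + t) ltac:(lra).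
  by have := sp.1 (u + s *: y) (v + t *: y); rewrite addrACA -scalerDl; lra.
- move=> t v t0; rewrite -ler_pdivrMl//; apply/ler_addgt0Pr => e e0.
  have [s s0 hs] := Alt v e e0.
  have ts : 0 <= t * s by rewrite mulr_ge0// ltW.
  have := Ale (t *: v) (t * s) ts.
  rewrite -scalerA -scalerDr sublinearZ// => h.
  rewrite ler_pdivrMl//; apply: (le_trans h); rewrite -mulrA -mulrBr.
  by rewrite ler_wpM2l ?(ltW t0)// ltW.
- by move=> v; have := Ale v 0 (lexx _); rewrite scale0r addr0 mul0r subr0.
- by move=> v; have := Ale v 1 ler01; rewrite scale1r mul1r.
Qed.

(* A minimal sublinear functional below [p] is linear: otherwise
   [sublinear_shift] would produce a smaller one. *)
Lemma hahn_banach p : sublinear p ->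
  exists2 f : V -> R^o, linear f & forall v, f v <= p v.
Proof.
move=> sp.
pose P (q : V -> R) := sublinear q /\ forall v, q v <= p v.
pose T := {q : V -> R | P q}.
(* The order is reversed: a maximal element for [r] is a pointwise minimal functional. *)
pose r (q1 q2 : T) := `[< forall v, sval q2 v <= sval q1 v >].
have [| | | |[q [sq qp]] qmin] := @Zorn T r.
- by move=> q; apply/asboolP.
- by move=> q1 q2 q3 /asboolP h1 /asboolP h2; apply/asboolP => v;
    exact: le_trans (h1 v).
- move=> [q1 P1] [q2 P2] /asboolP/= h1 /asboolP/= h2; apply: eq_exist.
  by apply/funext => v; apply/eqP; rewrite eq_le h1 h2.
- move=> A Atot; have [[q0 Aq0]|A0] := pselect (A !=set0); last first.
    exists (exist P p (conj sp (fun=> lexx _))) => s As; exfalso.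
    by apply: A0; exists s.
  pose B v := [set sval q v | q in A].
  have Binf v : has_inf (B v).
    split; first by exists (sval q0 v), q0.
    exists (- p (- v)) => _ [[q [sq qp]] _ <-] /=.
    by have := sublinearN v sq; have := qp (- v); lra.
  have Ble v q : A q -> inf (B v) <= sval q v.
    by move=> Aq; apply: ge_inf; [case: (Binf v)|exists q].
  have Blt v e : 0 < e -> exists2 q, A q & sval q v < inf (B v) + e.
    by move=> e0; have [_ [q Aq <-] h] := inf_adherent e0 (Binf v); exists q.
  have sB : sublinear (fun v => inf (B v)).
    split=> [u v|t v t0].
      apply/ler_addgt0Pr => e e0.
      have [q1 Aq1 h1] := Blt u (e / 2) ltac:(lra).
      have [q2 Aq2 h2] := Blt v (e / 2) ltac:(lra).
      (* In a chain, the smaller of [q1] and [q2] nearly attains both infima, so its subadditivity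
         suffices. *)
      have [/asboolP h12|/asboolP h21] := Atot _ _ Aq1 Aq2.
        have := Ble (u + v) q2 Aq2; have := (svalP q2).1.1 u v.
        by have := h12 u; lra.
      have := Ble (u + v) q1 Aq1; have := (svalP q1).1.1 u v.
      by have := h21 v; lra.
    rewrite -ler_pdivrMl//; apply/ler_addgt0Pr => e e0.
    have [q Aq h] := Blt v e e0.
    rewrite ler_pdivrMl//; apply: (le_trans (Ble _ _ Aq)).
    by rewrite (sublinearZ _ (svalP q).1)// ler_wpM2l ?(ltW t0)// ltW.
  have Bp v : inf (B v) <= p v.
    by apply: (le_trans (Ble _ _ Aq0)); exact: (svalP q0).2.
  exists (exist P _ (conj sB Bp)) => s As; apply/asboolP => v /=; exact: Ble.
exists q => //; apply: sublinear_additive_linear => // u v.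
have [q' sq' [q'q q'v]] := sublinear_shift v sq.
have q'p w : q' w <= p w by exact: le_trans (q'q w) (qp w).
have /(congr1 sval)/= q'E : exist P q' (conj sq' q'p) = exist P q (conj sq qp).
  by apply: qmin; apply/asboolP.
by have := q'v u; rewrite q'E; lra.
Qed.

End hahn_banach.

(** * Bounded functionals and their limits along ultrafilters *)

Section dual_tools.
Context (R : realType) (Y : normedModType R).
Implicit Types (f g : dual Y) (D : set (dual Y)).

Lemma bounded_linear_dual (f : Y -> R^o) (M : R) :
  linear f -> (forall y, `|f y| <= M * `|y|) ->
  exists g : dual Y, forall y, g y = f y.
Proof.
move=> lf fM.
pose F := HB.pack_for {linear Y -> R^o} f (GRing.isLinear.Build R Y R^o _ _ lf).
have Ff : f \in @is_functional R Y.
  rewrite inE; split=> //; apply: (@bounded_linear_continuous R Y R^o F).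
  apply/bounded_funP => r; exists (`|M| * r) => y yr.
  apply: (le_trans (fM y)); apply: (@le_trans _ _ (`|M| * `|y|)).
    by rewrite ler_wpM2r// ler_norm.
  by rewrite ler_wpM2l.
by exists (Dual Ff).
Qed.

Lemma dual_bounded_cvg (F : set_system nat) (FF : ProperFilter F)
    (u : nat -> dual Y) (M : R) :
  (forall n y, `|u n y| <= M * `|y|) ->
  (forall y, cvg (u n y @[n --> F])) ->
  exists f : dual Y, forall y, u n y @[n --> F] --> f y.
Proof.
move=> uM uc.
pose l (y : Y) : R^o := lim (u n y @[n --> F]).
have ul y : u n y @[n --> F] --> l y by exact: uc.
have [||f fl] := @bounded_linear_dual l M.
- move=> k y z; apply: cvg_lim => //.
  under eq_fun do rewrite linearP.
  by apply: cvgD; [apply: cvgZr; exact: ul|exact: ul].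
- move=> y; have nl : `|u n y| @[n --> F] --> `|l y|.
    by apply: cvg_norm; exact: ul.
  by apply: (cvgr_to_le nl); apply: nearW => n; exact: uM.
- by exists f => y; rewrite fl; exact: ul.
Qed.

Lemma ultra_bounded_cvg (F : set_system nat) (FF : UltraFilter F)
    (u : nat -> R) (M : R) : (forall n, `|u n| <= M) -> cvg (u n @[n --> F]).
Proof.
move=> uM; have := @segment_compact R (- M) M; rewrite compact_ultra.
have FU : UltraFilter (u n @[n --> F]).
  split; first exact: fmap_proper_filter.
  move=> G GF FG; apply/seteqP; split=> // A GA.
  have [//|FnA] := in_ultra_setVsetC (u @^-1` A) FF.
  have := @filter_not_empty _ G _; case; rewrite -(setICr A).
  by apply: filterI => //; exact: FG.
have FuM : F (u @^-1` [set` `[- M, M]]).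
  by apply: filterE => n /=; rewrite in_itv/= -ler_norml; exact: uM.
move=> /(_ _ FU FuM) [l [_ ul]].
by apply/cvg_ex; exists l.
Qed.

(** The Banach-Alaoglu theorem for sequences: each orbit [u n y] stays in a compact segment, and the
    limits inherit linearity and the bound. *)
Lemma dual_ultra_cvg (F : set_system nat) (FF : UltraFilter F)
    (u : nat -> dual Y) (M : R) :
  (forall n y, `|u n y| <= M * `|y|) ->
  exists f : dual Y, forall y, u n y @[n --> F] --> f y.
Proof.
move=> uM; apply: (@dual_bounded_cvg F _ u M uM) => y.
by apply: (@ultra_bounded_cvg F _ (fun n => u n y : R)) => n; exact: uM.
Qed.

End dual_tools.

Lemma convex_setP (R : realType) (V : lmodType R) (D : set V) : convex_set D <->
  forall f g t, D f -> D g -> 0 <= t -> t <= 1 -> D (t *: f + (1 - t) *: g).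
Proof.
split=> [cD f g t Df Dg t0 t1|cD f g l].
  by have := cD f g (Itv01 t0 t1); rewrite !inE; apply.
rewrite !inE => Df Dg; exact: cD.
Qed.

(** * Separation of a point from a convex set at positive distance *)

Section separation.
Context (R : realType) (Y : normedModType R).
Implicit Types (f g : Y) (D : set Y).

(** Apply Hahn-Banach to the infimum of [|v + t *: (f0 - d)| - t * r] over [t >= 0] and [d] in [D].
    It lies below the norm, so the functional is bounded, and [t = 1], [d = f] shows that it is at
    most [- r] at [f - f0]. *)
Lemma convex_separation D f0 (r : R) : convex_set D ->
  (forall f, D f -> r <= `|f0 - f|) ->
  exists phi : dual Y, forall f, D f -> phi f + r <= phi f0.
Proof.
move=> /convex_setP cD Dr.
have [[d0 Dd0]|D0] := pselect (D !=set0); last first.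
  by exists 0 => f Df; case: D0; exists f.
pose A v := [set `|v + z.1 *: (f0 - z.2)| - z.1 * r |
   z in [set z : R * Y | 0 <= z.1 /\ D z.2]].
have Alb v : lbound (A v) (- `|v|).
  move=> _ [[t d] /= [t0 Dd] <-].
  have := ler_normD (v + t *: (f0 - d)) (- v).
  rewrite addrC addKr normrN normrZ ger0_norm//.
  by have := ler_wpM2l t0 (Dr _ Dd); clear; lra.
have Ale v t d : 0 <= t -> D d -> inf (A v) <= `|v + t *: (f0 - d)| - t * r.
  by move=> t0 Dd; apply: ge_inf; [exists (- `|v|)|exists (t, d)].
have Ainf v : has_inf (A v).
  split; last by exists (- `|v|).
  by exists (`|v + 0 *: (f0 - d0)| - 0 * r), (0, d0).
have Alt v e : 0 < e -> exists t d, [/\ 0 <= t, D d &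
    `|v + t *: (f0 - d)| - t * r < inf (A v) + e].
  move=> e0; have [_ [[t d] /= [t0 Dd] <-] h] := inf_adherent e0 (Ainf v).
  by exists t, d.
have Anorm v : inf (A v) <= `|v|.
  by have := Ale v 0 d0 (lexx _) Dd0; rewrite scale0r addr0 mul0r subr0.
have [|phi lphi phiA] := @hahn_banach R Y (fun v => inf (A v)).
  split=> [u v|t v t0].
    apply/ler_addgt0Pr => e e0.
    have [s [d [s0 Dd hs]]] := Alt u (e / 2) ltac:(lra).
    have [t [d' [t0 Dd' ht]]] := Alt v (e / 2) ltac:(lra).
    have [/eqP|st0] := eqVneq (s + t) 0.
      rewrite paddr_eq0// => /andP[/eqP sE /eqP tE].
      move: hs ht; rewrite sE tE !scale0r !addr0 !mul0r !subr0 => hs ht.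
      have := Anorm (u + v); have := ler_normD u v; clear -hs ht.
      by lra.
    have st1 : 0 < s + t by rewrite lt_def st0 addr_ge0.
    (* Merging the two near-minimizers, with total parameter [s + t], requires the convex
       combination of [d] and [d'] with weights proportional to [s] and [t]. *)
    pose w := s / (s + t).
    have ws : (s + t) * w = s by rewrite /w mulrCA mulfV// mulr1.
    have w0 : 0 <= w by rewrite divr_ge0// ltW.
    have w1 : w <= 1 by rewrite ler_pdivrMr// mul1r lerDl.
    have := Ale (u + v) (s + t) _ (ltW st1) (cD _ _ _ Dd Dd' w0 w1).
    have -> : u + v + (s + t) *: (f0 - (w *: d + (1 - w) *: d')) =
        (u + s *: (f0 - d)) + (v + t *: (f0 - d')).
      rewrite [RHS]addrACA; congr (_ + _).
      rewrite !scalerBr scalerDr !scalerA mulrBr mulr1 ws.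
      by rewrite [s + t - s]addrAC subrr add0r scalerDl opprD addrACA.
    have := ler_normD (u + s *: (f0 - d)) (v + t *: (f0 - d')).
    by clear -hs ht; lra.
  rewrite -ler_pdivrMl//; apply/ler_addgt0Pr => e e0.
  have [s [d [s0 Dd hs]]] := Alt v e e0.
  rewrite ler_pdivrMl//.
  have := Ale (t *: v) (t * s) d (mulr_ge0 (ltW t0) s0) Dd.
  rewrite -scalerA -scalerDr normrZ gtr0_norm// -mulrA -mulrBr => /le_trans.
  by apply; rewrite ler_wpM2l ?(ltW t0)// ltW.
have phiN v : phi (- v) = - phi v.
  have lphi0 : phi 0 = 0.
    by have := lphi 1 0 0; rewrite !scale1r addr0; clear; lra.
  by have := lphi (-1) v 0; rewrite !addr0 !scaleN1r lphi0 addr0.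
have [||psi psiE] := @bounded_linear_dual _ _ phi 1.
- exact: lphi.
- move=> v; rewrite mul1r ler_norml; apply/andP; split.
    by rewrite lerNl -phiN -[`|v|]normrN (le_trans (phiA _)).
  by rewrite (le_trans (phiA _)).
exists psi => f Df; rewrite !psiE.
have := phiA (f - f0); have := Ale (f - f0) 1 f ler01 Df.
rewrite scale1r addrA subrK subrr normr0 mul1r.
have : phi (f - f0) = phi f - phi f0.
  by have := lphi 1 f (- f0); rewrite !scale1r phiN.
by clear; lra.
Qed.

End separation.

(** * Decreasing sequences of convex sets of functionals *)

Section nests.
Context (R : realType) (X : normedModType R).
Implicit Types (f g h : dual X) (D : nat -> set (dual X)) (x : X).

Definition nest D :=
  [/\ forall n, D n !=set0, forall n, convex_set (D n) &
      forall n, D n.+1 `<=` D n].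

Lemma nest_sub D m n : nest D -> (m <= n)%N -> D n `<=` D m.
Proof.
move=> [_ _ DS] /subnKC <-; elim: (n - m)%N => [|k IHk]; first by rewrite addn0.
by rewrite addnS; exact: subset_trans (DS _) IHk.
Qed.

(** The level [n] may depend on [x]; the infimum of the admissible [e] is the oscillation of the
    nest. *)
Definition osc_le D (e : R) := forall x, `|x| <= 1 ->
  exists n, forall g h, D n g -> D n h -> g x - h x <= e.

Lemma osc_le_ge0 D e : nest D -> osc_le D e -> 0 <= e.
Proof.
move=> [D0 _ _] /(_ 0); rewrite normr0 => /(_ ler01)[n Dn].
by have [g Dg] := D0 n; have := Dn g g Dg Dg; rewrite subrr.
Qed.

Lemma osc_leW D e e' : e <= e' -> osc_le D e -> osc_le D e'.
Proof.
move=> ee' De x /De[n Dn]; exists n => g h Dg Dh.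
exact: le_trans (Dn _ _ Dg Dh) ee'.
Qed.

Lemma osc_le_eventually D D' k e : nest D -> nest D' ->
  (forall n, (k <= n)%N -> D' n `<=` D n) -> osc_le D e -> osc_le D' e.
Proof.
move=> nD nD' DD De x /De[n Dn]; exists (maxn k n) => g h Dg Dh.
have sD : D' (maxn k n) `<=` D n.
  apply: subset_trans (nest_sub nD (leq_maxr k n)); exact/DD/leq_maxl.
by apply: Dn; exact: sD.
Qed.

Lemma osc_le_sub D D' e : nest D -> nest D' ->
  (forall n, D' n `<=` D n) -> osc_le D e -> osc_le D' e.
Proof. by move=> nD nD' DD; apply: (@osc_le_eventually D D' 0). Qed.

Lemma osc_near_minimal D e0 (r : R) : nest D -> osc_le D e0 -> 0 < r ->
  exists D0, [/\ nest D0, forall n, D0 n `<=` D n &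
    forall D' e, nest D' -> (forall n, D' n `<=` D n) -> osc_le D' e ->
      osc_le D0 (e + r)].
Proof.
move=> nD De0 r0.
pose E := [set e | exists D',
  [/\ nest D', forall n, D' n `<=` D n & osc_le D' e]].
have Einf : has_inf E.
  split; first by exists e0, D; split=> // n; exact: subset_refl.
  by exists 0 => e [D' [nD' _]]; exact: osc_le_ge0.
have [e1 [D0 [nD0 D0D D0e]] e1r] := inf_adherent r0 Einf.
exists D0; split=> // D' e nD' D'D D'e; apply: osc_leW D0e.
have : inf E <= e by apply: ge_inf; [case: Einf|exists D'].
by move: e1r; clear; lra.
Qed.

(** Minimality of the oscillation among sub-nests; the slack [r] is there because bounds need not be
    attained. *)
Definition stable D := forall D' e (r : R), nest D' ->
  (forall n, D' n `<=` D n) -> osc_le D' e -> 0 < r -> osc_le D (e + r).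

(** Diagonal argument: [F k.+1] is minimal up to [1/(k+1)] among the sub-nests of [F k], and the
    diagonal [G] is eventually inside every [F k]. *)
Lemma stable_nest_ex D e0 : nest D -> osc_le D e0 ->
  exists D', [/\ nest D', forall n, D' n `<=` D n & stable D'].
Proof.
move=> nD De0.
pose P D := nest D /\ osc_le D e0; pose T := {D | P D}.
have /choice[step stepP] (p : nat * T) : exists D0 : T,
    (forall n, sval D0 n `<=` sval p.2 n) /\
    forall D' e, nest D' -> (forall n, D' n `<=` sval p.2 n) -> osc_le D' e ->
      osc_le (sval D0) (e + p.1.+1%:R^-1).
  case: p => k [D1 [nD1 D1e]] /=.
  have [|D0 [nD0 D01 D0m]] := @osc_near_minimal D1 e0 k.+1%:R^-1 nD1 D1e.
    by rewrite invr_gt0.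
  by exists (exist P D0 (conj nD0 (osc_le_sub nD1 nD0 D01 D1e))).
pose F := fix F n : T :=
  if n is k.+1 then step (k, F k) else exist P D (conj nD De0).
have nF k : nest (sval (F k)) by exact: (svalP (F k)).1.
have FS k n : sval (F k.+1) n `<=` sval (F k) n by exact: (stepP (k, F k)).1.
have FD j k n : (j <= k)%N -> sval (F k) n `<=` sval (F j) n.
  move=> /subnKC <-; elim: (k - j)%N => [|i IHi]; first by rewrite addn0.
  by rewrite addnS; exact: subset_trans (FS _ _) IHi.
pose G n := sval (F n) n.
have nG : nest G.
  split=> n; have [F0 cF FFS] := nF n; [exact: F0|exact: cF|].
  exact: subset_trans (FS n _) (FFS _).
exists G; split=> // [n|D' e r nD' D'G D'e r0]; first exact: (FD 0 n n).
have [k /= kr] : exists k, k.+1%:R^-1 < r.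
  exists (Num.truncn r^-1); rewrite invf_plt ?posrE//.
  exact: truncnS_gt.
(* [D'] is inside [F k] only from level [k] on; the shift achieves this at all levels without
   changing the tail. *)
pose D'' n := D' (maxn k n).
have nD'' : nest D''.
  have [D'0 cD' _] := nD'; split=> n; [exact: D'0|exact: cD'|].
  apply: (nest_sub nD'); rewrite geq_max leq_maxl/= (leq_trans (leqnSn n))//.
  exact: leq_maxr.
have D''F n : D'' n `<=` sval (F k) n.
  apply: subset_trans (D'G _) _; rewrite /G.
  apply: subset_trans (FD _ _ _ (leq_maxl k n)) _.
  exact: nest_sub (leq_maxr k n).
have D''e : osc_le D'' e.
  apply: (@osc_le_eventually D' D'' k) => // n kn.
  by rewrite /D'' (maxn_idPr kn).
have := (stepP (k, F k)).2 D'' e nD'' D''F D''e => /= h.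
apply: (@osc_leW _ (e + k.+1%:R^-1)); first by rewrite lerD2l ltW.
apply: (@osc_le_eventually (sval (F k.+1)) G k.+1) => // n kn.
exact: FD.
Qed.

End nests.

(** * Simultaneous oscillation of finitely many sub-nests *)

Section independence.
Context (R : realType) (X : normedModType R).
Implicit Types (f g h : dual X) (D : nat -> set (dual X)) (x : X).

(* The weights 1/2, 1/4, ... are immaterial as long as they are positive: an
   element of the average that is nearly maximal at [x] has only nearly maximal
   components. *)
Fixpoint average D (I : Type) (H : I -> nat -> set (dual X)) (l : seq I) n :=
  if l is i :: l' then
    [set f | exists g h, [/\ H i n g, average D H l' n h &
                             f = 2^-1 *: g + (1 - 2^-1) *: h]]
  else D n.

Lemma average_nest D (I : Type) (H : I -> nat -> set (dual X)) l :
  nest D -> (forall i, nest (H i)) -> nest (average D H l).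
Proof.
move=> nD nH; elim: l => [//|i l [A0 cA AS]] /=; have [H0 cH HS] := nH i.
split=> n.
- have [g Hg] := H0 n; have [h Ah] := A0 n.
  by exists (2^-1 *: g + (1 - 2^-1) *: h), g, h.
- apply/convex_setP => _ _ t [g [h [Hg Ah ->]]] [g' [h' [Hg' Ah' ->]]] t0 t1.
  exists (t *: g + (1 - t) *: g'), (t *: h + (1 - t) *: h'); split.
  + by have /convex_setP := cH n; apply.
  + by have /convex_setP := cA n; apply.
  + rewrite !scalerDr !scalerA addrACA.
    by rewrite ![t * _]mulrC ![(1 - t) * _]mulrC.
- move=> _ [g [h [Hg Ah ->]]]; exists g, h; split=> //; [exact: HS|exact: AS].
Qed.

Lemma average_sub D (I : Type) (H : I -> nat -> set (dual X)) l :
  nest D -> (forall i n, H i n `<=` D n) ->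
  forall n, average D H l n `<=` D n.
Proof.
move=> [_ cD _] HD n; elim: l => [//|i l IHl] _ /= [g [h [Hg Ah ->]]].
have /convex_setP := cD n; apply; [exact: HD Hg|exact: IHl|lra|lra].
Qed.

(** No component exceeds [t] at [x], so each halving of the weight at most doubles the defect; this
    gives the factor [2 ^+ size l]. *)
Lemma average_component D (I : eqType) (H : I -> nat -> set (dual X)) l n x
    (t r : R) f :
  nest D -> (forall i n, H i n `<=` D n) -> (forall g, D n g -> g x <= t) ->
  average D H l n f -> t - r < f x ->
  forall i, i \in l -> exists2 g, H i n g & t - 2 ^+ size l * r < g x.
Proof.
move=> nD HD Dt; elim: l r f => [//|j l IHl] r f /= [g [h [Hg Ah fE]]].
have gt := Dt _ (HD _ _ _ Hg); have ht := Dt _ (average_sub nD HD Ah).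
have -> : f x = 2^-1 * g x + (1 - 2^-1) * h x by rewrite fE.
move=> fr i; have [r0 gr hr] : [/\ 0 < r, t - 2 * r < g x & t - 2 * r < h x].
  by move: (g x) (h x) gt ht fr => gx hx; clear; split; lra.
rewrite inE => /predU1P[->|il].
  exists g => //; apply: le_lt_trans gr.
  rewrite lerD2l lerN2 exprS -mulrA ler_pM2l//.
  by rewrite ler_peMl ?exprn_ege1 ?ler1n ?ltW.
by have [k Hk] := IHl _ h Ah hr i il; rewrite mulrA -exprSr; exists k.
Qed.

Lemma average_component_low D (I : eqType) (H : I -> nat -> set (dual X)) l n x
    (b r : R) f :
  nest D -> (forall i n, H i n `<=` D n) -> (forall g, D n g -> b <= g x) ->
  average D H l n f -> f x < b + r ->
  forall i, i \in l -> exists2 g, H i n g & g x < b + 2 ^+ size l * r.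
Proof.
move=> nD HD Db Af fr i il.
have [||g Hg] := @average_component D I H l n (- x) (- b) r f nD HD _ Af _ i il.
- by move=> g /Db; rewrite raddfN lerN2.
- by rewrite raddfN -opprD ltrN2.
- by rewrite raddfN -opprD ltrN2; exists g.
Qed.

Lemma common_oscillation D (d : R) (I : eqType) (H : I -> nat -> set (dual X))
    (l : seq I) :
  nest D -> stable D -> 0 < d -> (forall e, d < e -> osc_le D e) ->
  (forall e, e < d -> ~ osc_le D e) ->
  (forall i, nest (H i)) -> (forall i n, H i n `<=` D n) ->
  exists x (a b : R), [/\ `|x| <= 1, b + d / 2 <= a &
    forall i n, i \in l ->
      (exists2 g, H i n g & a <= g x) /\ (exists2 g, H i n g & g x <= b)].
Proof.
move=> nD sD d0 Dd dD nH HD.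
have [K K1 KE] : exists2 K : R, 1 <= K & 2 ^+ size l = K.
  by exists (2 ^+ size l); rewrite ?exprn_ege1 ?ler1n.
(* Below, [t - b > d - r], and each of the two levels gives up [2 * (K * r) = d / 5]; since
   [r <= d / 10], a gap of [d / 2] remains. *)
pose r := d / (10 * K).
have r0 : 0 < r by rewrite divr_gt0// mulr_gt0// (lt_le_trans _ K1).
have Kr : K * r = d / 10.
  by rewrite /r; field; rewrite gt_eqF// (lt_le_trans _ K1).
pose A := average D H l.
have nA : nest A by exact: average_nest.
have AD : forall n, A n `<=` D n by exact: average_sub.
(* Otherwise the average would have oscillation at most [d - r], and stability would bring that of
   [D] below [d]. *)
have [x x1 Ax] : exists2 x, `|x| <= 1 &
    forall n, exists g h, [/\ A n g, A n h & d - r < g x - h x].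
  apply: contrapT => nx.
  have Ad : osc_le A (d - r).
    move=> x x1; apply: contrapT => nA'; apply: nx; exists x => // n.
    apply: contrapT => ngh; apply: nA'; exists n => g h Ag Ah.
    by rewrite leNgt; apply/negP => ghx; apply: ngh; exists g, h.
  apply: (dD (d - r + r / 2)); first by move: r0; clear; lra.
  by apply: (sD A) => //; move: r0; clear; lra.
have [N DN] := Dd (d + r) ltac:(clear -r0; lra) x x1.
pose E := [set g x | g in D N].
have [g0 Dg0] : D N !=set0 by case: nD.
have Es : has_sup E.
  split; first by exists (g0 x), g0.
  exists (g0 x + (d + r)) => _ [g Dg <-].
  by rewrite -lerBlDl; exact: DN.
have Ei : has_inf E.
  split; first by exists (g0 x), g0.
  exists (g0 x - (d + r)) => _ [g Dg <-].
  by rewrite lerBlDl -lerBlDr; exact: DN.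
pose t := sup E; pose b := inf E.
have Dt n g : (N <= n)%N -> D n g -> g x <= t.
  move=> /(nest_sub nD) sD' /sD' Dg.
  by apply: ub_le_sup; [case: Es|exists g].
have Db n g : (N <= n)%N -> D n g -> b <= g x.
  move=> /(nest_sub nD) sD' /sD' Dg.
  by apply: ge_inf; [case: Ei|exists g].
have tb : t - b <= d + r.
  rewrite lerBlDr -lerBlDl; apply: lb_le_inf; first by case: Ei.
  move=> _ [h Dh <-]; rewrite lerBlDr; apply: ge_sup; first by case: Es.
  by move=> _ [g Dg <-]; rewrite -lerBlDl; exact: DN.
(* The values of [D] at [x] span at most [d + r], so a pair in the average more than [d - r] apart
   comes within [2 * r] of both extremes. *)
have Agap n : (N <= n)%N -> exists g h,
    [/\ A n g, A n h, t - 2 * r < g x, h x < b + 2 * r & d - r < t - b].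
  move=> Nn; have [g [h [Ag Ah gh]]] := Ax n; exists g, h.
  suff : [/\ t - 2 * r < g x, h x < b + 2 * r & d - r < t - b].
    by case=> *; split.
  have := Dt n g Nn (AD _ _ Ag); have := Db n h Nn (AD _ _ Ah).
  by move: tb gh; move: (g x) (h x) (t) (b) => gx hx t' b'; clear; split; lra.
exists x, (t - 2 * (K * r)), (b + 2 * (K * r)).
split=> //.
  have [g [h [_ _ _ _]]] := Agap N (leqnn N).
  rewrite Kr; have : r <= d / 10 by rewrite -Kr ler_peMl// ltW.
  by move: (t) (b) => t' b'; clear; lra.
(* The extremes bound [D] only from level [N] on, hence the detour through [maxn N n]. *)
move=> i n il; have Nm := leq_maxl N n; have nm := leq_maxr N n.
have [g [h [Ag Ah gt hb _]]] := Agap _ Nm; split.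
  have [k Hk kt] := average_component nD HD (fun g => @Dt _ g Nm) Ag gt il.
  exists k; first exact: nest_sub nm _ Hk.
  by move: kt; rewrite KE mulrCA => /ltW.
have [k Hk kb] := average_component_low nD HD (fun g => @Db _ g Nm) Ah hb il.
exists k; first exact: nest_sub nm _ Hk.
by move: kb; rewrite KE mulrCA => /ltW.
Qed.

End independence.

(** * Independent half-spaces *)

Section independent_sequences.
Context (R : realType) (X : normedModType R).
Implicit Types (f g h : dual X) (D : nat -> set (dual X)) (x : X).

(* The triple [((x, a), b)] stands for the two half-spaces [a <= g x] (side
   [false]) and [g x <= b] (side [true]), both encoded as [g p.1 <= p.2]. *)
Definition side (s : X * R * R) (c : bool) : X * R :=
  if c then (s.1.1, s.2) else (- s.1.1, - s.1.2).

Definition in_side (s : X * R * R) (c : bool) g :=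
  g (side s c).1 <= (side s c).2.

(** Only finite patterns are required; infinite ones are reached in the dual ball by compactness. *)
Definition independent (B : set (dual X)) (s : nat -> X * R * R) :=
  forall (sigma : nat -> bool) n,
    exists2 g, B g & forall i, (i < n)%N -> in_side (s i) (sigma i) g.

Lemma in_side_convex s c f g t : in_side s c f -> in_side s c g ->
  0 <= t -> t <= 1 -> in_side s c (t *: f + (1 - t) *: g).
Proof.
rewrite /in_side => fe ge t0 t1; rewrite -subr_ge0 in t1.
have := lerD (ler_wpM2l t0 fe) (ler_wpM2l t1 ge).
by rewrite -mulrDl [t + _]addrC subrK mul1r.
Qed.

Lemma independent_sequence_ex D (d : R) :
  nest D -> stable D -> 0 < d -> (forall e, d < e -> osc_le D e) ->
  (forall e, e < d -> ~ osc_le D e) ->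
  exists2 s : nat -> X * R * R,
    (forall n, `|(s n).1.1| <= 1 /\ (s n).2 + d / 2 <= (s n).1.2) &
    independent (D 0%N) s.
Proof.
move=> nD sD d0 Dd dD.
(* A default value, for [nth] and for lists violating the invariant. *)
pose s0 : X * R * R := (0, 0, 0).
(* Witnesses are demanded at every level [k], so that each sign pattern cuts a sub-nest out of
   [D]. *)
pose inv (L : seq (X * R * R)) := forall (sigma : nat -> bool) k,
  exists2 g, D k g &
    forall i, (i < size L)%N -> in_side (nth s0 L i) (sigma i) g.
have /choice[step stepP] (L : seq (X * R * R)) : exists s : X * R * R, inv L ->
    [/\ `|s.1.1| <= 1, s.2 + d / 2 <= s.1.2 & inv (rcons L s)].
  have [invL|] := pselect (inv L); last by exists s0.
  pose H (tau : (size L).-tuple bool) k := D k `&`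
    [set g | forall i, (i < size L)%N ->
      in_side (nth s0 L i) (nth false tau i) g].
  have nH tau : nest (H tau).
    have [_ cD DS] := nD; split=> k.
    - by have [g Dg Lg] := invL (nth false tau) k; exists g.
    - apply/convex_setP => f g t [Df Lf] [Dg Lg] t0 t1; split.
        by have /convex_setP := cD k; apply.
      by move=> i iL; apply: in_side_convex; [exact: Lf|exact: Lg| |].
    - by move=> g [Dg Lg]; split=> //; exact: DS.
  have HD tau k : H tau k `<=` D k by move=> g [].
  (* One point and one pair of levels serve all patterns on [L] at once, so both sides of the new
     pair are compatible with each of them. *)
  have [x [a [b [x1 ab xab]]]] := common_oscillation
    (enum {: (size L).-tuple bool}) nD sD d0 Dd dD nH HD.
  exists (x, a, b) => _; split=> // sigma k.
  pose tau : (size L).-tuple bool := [tuple sigma i | i < size L].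
  have tauE i : (i < size L)%N -> nth false tau i = sigma i.
    by move=> iL; rewrite -[i]/(val (Ordinal iL)) -tnth_nth tnth_mktuple.
  have [|[f [Df Lf] fa] [g [Dg Lg] gb]] := xab tau k; first by rewrite mem_enum.
  have [sb|sb] := boolP (sigma (size L)); [exists g => //|exists f => //];
    move=> i; rewrite size_rcons ltnS leq_eqVlt => /predU1P[->|iL];
    rewrite nth_rcons ?ltnn ?eqxx ?iL.
  - by rewrite sb.
  - by rewrite -tauE//; exact: Lg.
  - by rewrite (negbTE sb) /in_side /= raddfN lerN2.
  - by rewrite -tauE//; exact: Lf.
pose F := fix F n := if n is k.+1 then rcons (F k) (step (F k)) else [::].
have invF n : inv (F n).
  elim: n => [sigma k|n /stepP[]//].
  by have [D0 _ _] := nD; have [g Dg] := D0 k; exists g.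
have sF n : size (F n) = n by elim: n => //= n IHn; rewrite size_rcons IHn.
have nF n i : (i < n)%N -> nth s0 (F n) i = step (F i).
  elim: n => [//|n IHn]; rewrite ltnS leq_eqVlt /= nth_rcons sF.
  by move=> /predU1P[->|iN]; rewrite ?ltnn ?eqxx// iN; exact: IHn.
exists (fun n => step (F n)) => [n|sigma n]; first by have [] := stepP _ (invF n).
have [g Dg Lg] := invF n sigma 0%N; exists g => // i iN.
by rewrite -(nF n)//; apply: Lg; rewrite sF.
Qed.

Definition ball_dual (M : R) g := forall x, `|g x| <= M * `|x|.

(** A limit along a free ultrafilter keeps every eventual upper bound; lower bounds are upper bounds
    at [- x]. *)
Lemma ball_dual_seq_compact M (u : nat -> dual X) :
  (forall n, ball_dual M (u n)) ->
  exists2 f, ball_dual M f &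
    forall x c N, (forall n, (N <= n)%N -> u n x <= c) -> f x <= c.
Proof.
move=> uM; have [U [UU oU]] := ultraFilterLemma (F := \oo) _.
have [f uf] := dual_ultra_cvg UU uM.
have fle x c N : (forall n, (N <= n)%N -> u n x <= c) -> f x <= c.
  move=> uc; apply: (cvgr_to_le (uf x)).
  by apply: oU; exists N.
exists f => // x; rewrite ler_norml; apply/andP; split.
  rewrite lerNl -raddfN; apply: (fle _ _ 0%N) => n _.
  by have := uM n (- x); rewrite ler_norml normrN => /andP[].
by apply: (fle _ _ 0%N) => n _; have := uM n x; rewrite ler_norml => /andP[].
Qed.

End independent_sequences.

(** * A Baire category argument on patterns of sides *)

Section baire.
Context (R : realType) (X : normedModType R).
Implicit Types (f g h : dual X) (x : X) (s : nat -> X * R * R) (y : nat -> X).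

Lemma in_side_false (t : X * R * R) g : in_side t false g -> t.1.2 <= g t.1.1.
Proof. by rewrite /in_side /= raddfN lerN2. Qed.

(** These sets, increasing in [k], are closed under pointwise limits, and for [r > 0] they exhaust
    the ball when every [g (y n)] converges. *)
Definition steady (M : R) y (r : R) k g := ball_dual M g /\
  forall i j, (k <= i)%N -> (k <= j)%N -> g (y i) - g (y j) <= r.

Definition in_sides s (sigma : nat -> bool) g :=
  forall i, in_side (s i) (sigma i) g.

Lemma steady_limit M y r k s sigma (u : nat -> dual X) :
  (forall n, steady M y r k (u n)) ->
  (forall n i, (i < n)%N -> in_side (s i) (sigma i) (u n)) ->
  exists g, [/\ steady M y r k g, in_sides s sigma g &
    forall x c, (forall n, u n x <= c) -> g x <= c].
Proof.
move=> us usg; have [g gM gle] := ball_dual_seq_compact (fun n => (us n).1).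
exists g; split=> [|i|x c uc]; last by apply: (gle x c 0%N) => n _; exact: uc.
  split=> // i j ki kj; rewrite -raddfB; apply: (gle _ _ 0%N) => n _.
  by rewrite raddfB; exact: (us n).2.
by apply: (gle _ _ i.+1) => n ni; exact: usg.
Qed.

(* Baire's theorem on [nat -> bool], by nested cylinders. *)
Lemma steady_cylinder M y r s : independent (ball_dual M) s -> 0 < r ->
  (forall g, cvgn (fun n => g (y n))) ->
  exists k n0 (sigma0 : nat -> bool), forall sigma,
    (forall i, (i < n0)%N -> sigma i = sigma0 i) ->
    exists2 g, steady M y r k g & in_sides s sigma g.
Proof.
move=> indep r0 ycvg; apply: contrapT => nex.
have /choice[step stepP] (p : nat * (nat * (nat -> bool))) :
    exists q : nat * (nat -> bool),
    [/\ (p.1 < q.1)%N, (p.2.1 <= q.1)%N,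
        forall i, (i < p.2.1)%N -> q.2 i = p.2.2 i &
      ~ exists2 g, steady M y r p.1 g &
          forall i, (i < q.1)%N -> in_side (s i) (q.2 i) g].
  case: p => k [n0 sigma0] /=; apply: contrapT => nq; apply: nex.
  exists k, n0, sigma0 => sigma sigmaE.
  (* If every finite part of [sigma] admits a steady functional, a limit point is steady and
     realizes all of [sigma]. *)
  have /choice[u uP] (n : nat) : exists g, steady M y r k g /\
      forall i, (i < n)%N -> in_side (s i) (sigma i) g.
    apply: contrapT => ng; apply: nq; exists (maxn n (maxn k.+1 n0), sigma).
    split=> //=; first by rewrite !leq_max leqnn orbT.
      by rewrite !leq_max leqnn !orbT.
    move=> [g gs gsg]; apply: ng; exists g; split=> // i iN; apply: gsg.
    by rewrite leq_max iN.
  have [g [gs gsg _]] := steady_limit (fun n => (uP n).1) (fun n => (uP n).2).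
  by exists g.
pose F := fix F n : nat * (nat -> bool) :=
  if n is k.+1 then step (k, F k) else (0%N, fun=> false).
have F1 k : (k <= (F k).1)%N by case: k => //= k; have [] := stepP (k, F k).
have FS k i : (i < (F k).1)%N -> (F k.+1).2 i = (F k).2 i.
  by have [_ _ + _] := stepP (k, F k); apply.
have F1S k : ((F k).1 <= (F k.+1).1)%N by have [] := stepP (k, F k).
have FD k j i : (k <= j)%N -> (i < (F k).1)%N -> (F j).2 i = (F k).2 i.
  move=> /subnKC <- ik; suff [] : (i < (F (k + (j - k))%N).1)%N /\
    (F (k + (j - k))%N).2 i = (F k).2 i by [].
  elim: (j - k)%N => [|m [im IHm]]; first by rewrite addn0.
  by rewrite addnS FS// (leq_trans im).
(* The common point of the nested cylinders: [F i.+1] already fixes coordinate [i]. A functional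
   realizing it is steady from some [k] on, against the choice made at stage [k]. *)
pose sigma i := (F i.+1).2 i.
have sigmaE k i : (i < (F k).1)%N -> sigma i = (F k).2 i.
  move=> ik; have [ki|ik'] := leqP k i.+1; first exact: FD.
  by rewrite /sigma -(FD i.+1 k) ?(ltnW ik').
have /choice[u uP] (n : nat) : exists g, ball_dual M g /\
    forall i, (i < n)%N -> in_side (s i) (sigma i) g.
  by have [g gM gs] := indep sigma n; exists g.
have [g gM gle] := ball_dual_seq_compact (fun n => (uP n).1).
have gs : in_sides s sigma g.
  by move=> i; apply: (gle _ _ i.+1) => n ni; exact: (uP n).2.
have [k gk] : exists k, steady M y r k g.
  have /cvg_ex[l gl] := ycvg g.
  have r20 : 0 < r / 2 by rewrite divr_gt0.
  move/cvgrPdist_le : gl => /(_ _ r20)[k _ kl].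
  exists k; split=> // i j ki kj.
  have := kl i ki; have := kl j kj; rewrite /= !ler_norml.
  by move: (g (y i)) (g (y j)) => gi gj; clear; lra.
have [_ _ _] := stepP (k, F k); apply; exists g => // i iF.
by rewrite -(sigmaE k.+1)//; exact: gs.
Qed.

(** On a good cylinder, [phi g] is within [r] of [g (y k)]. Patterns ending in [false] give
    [phi g >= a], those ending in [true] give [phi g <= b], yet the former accumulate at the latter
    and [a - b >= 4 * r]. *)
Lemma independent_not_baire1 M s (d : R) (phi : dual (dual X)) y
    (U : set_system nat) : UltraFilter U -> \oo `<=` U -> 0 < d ->
  independent (ball_dual M) s ->
  (forall n, `|(s n).1.1| <= 1 /\ (s n).2 + d / 2 <= (s n).1.2) ->
  (forall g, g (s n).1.1 @[n --> U] --> phi g) ->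
  (forall g, g (y n) @[n --> \oo] --> phi g) -> False.
Proof.
move=> UU oU d0 indep gap xphi yphi.
have [r r0 dr] : exists2 r, 0 < r & d = 8 * r.
  by exists (d / 8); [rewrite divr_gt0|rewrite mulrC divfK].
have ycvg g : cvgn (fun n => g (y n)) by apply/cvg_ex; exists (phi g).
have [k [n0 [sigma0 cyl]]] := steady_cylinder indep r0 ycvg.
have bnd n : `|(s n).1.2| <= `|M| + d /\ `|(s n).2| <= `|M| + d.
  have [x1 ab] := gap n.
  have gx g : ball_dual M g -> `|g (s n).1.1| <= `|M|.
    move=> /(_ (s n).1.1) /le_trans; apply.
    rewrite (@le_trans _ _ (`|M| * `|(s n).1.1|))//.
      by rewrite ler_wpM2r// ler_norm.
    by rewrite ler_piMr.
  have [f /gx fM /(_ n (ltnSn _)) /in_side_false] := indep (fun=> false) n.+1.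
  have [g /gx gM /(_ n (ltnSn _))] := indep (fun=> true) n.+1.
  rewrite /in_side /=; move: fM gM ab; rewrite !ler_norml.
  move: (f _) (g _) (s n).2 (s n).1.2 `|M| => fx gx' b a m.
  move=> /andP[h1 h2] /andP[h3 h4] h5 h6 h7.
  move: d0 h1 h2 h3 h4 h5 h6 h7; clear.
  by move=> *; split; apply/andP; split; lra.
have [a aE] : exists a : R^o, (s n).1.2 @[n --> U] --> a.
  have /cvg_ex[a aE] := ultra_bounded_cvg UU (fun n => (bnd n).1).
  by exists a.
have [b bE] : exists b : R^o, (s n).2 @[n --> U] --> b.
  have /cvg_ex[b bE] := ultra_bounded_cvg UU (fun n => (bnd n).2).
  by exists b.
have ab : b + 4 * r <= a.
  have bE' : (s n).2 + 4 * r @[n --> U] --> b + 4 * r.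
    by apply: cvgD; [exact: bE|exact: cvg_cst].
  apply: (ler_cvg_to bE' aE).
  apply: nearW => n; have [_] := gap n; rewrite dr.
  by move: (s n).2 (s n).1.2 => ? ?; clear; lra.
have phi_false sigma g N : in_sides s sigma g ->
    (forall i, (N <= i)%N -> sigma i = false) -> a <= phi g.
  move=> gs sN; apply: (ler_cvg_to aE (xphi g)); apply: oU.
  exists N => // n /= Nn.
  by have := gs n; rewrite sN// => /in_side_false.
have phi_true sigma g N : in_sides s sigma g ->
    (forall i, (N <= i)%N -> sigma i = true) -> phi g <= b.
  move=> gs sN; apply: (ler_cvg_to (xphi g) bE); apply: oU.
  exists N => // n /= Nn.
  by have := gs n; rewrite sN.
have steady_le g : steady M y r k g -> phi g <= g (y k) + r.
  move=> [_ gk]; apply: (cvgr_to_le (yphi g)); exists k => // n /= kn.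
  by rewrite -lerBlDl; exact: gk.
have steady_ge g : steady M y r k g -> g (y k) - r <= phi g.
  move=> [_ gk]; apply: (cvgr_to_ge (yphi g)); exists k => // n /= kn.
  by rewrite lerBlDr -lerBlDl; exact: gk.
pose sigma i := if (i < n0)%N then sigma0 i else true.
have /choice[u uP] (n : nat) : exists g, [/\ steady M y r k g,
    forall i, (i < n)%N -> in_side (s i) (sigma i) g & a <= phi g].
  (* This pattern agrees with [sigma] below [n] but is eventually [false]. *)
  pose sigma' i := if (i < n0)%N then sigma0 i else (i < n)%N.
  have [i iN|g gk gs] := cyl sigma'; first by rewrite /sigma' iN.
  exists g; split=> //.
    by move=> i iN; have := gs i; rewrite /sigma' /sigma iN.
  apply: (phi_false _ _ (maxn n0 n) gs) => i; rewrite geq_max => /andP[ni0 ni].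
  by rewrite /sigma' ltnNge ni0/= ltnNge ni.
have us n : steady M y r k (u n) by have [] := uP n.
have [|g [gk gs gle]] := @steady_limit M y r k s sigma u us.
  by move=> n; have [] := uP n.
have gy : g (- y k) <= r - a.
  apply: gle => n; have [_ _ ua] := uP n; have := steady_le _ (us n).
  rewrite raddfN /=; move: (u n (y k)) (phi (u n)) ua => uy pu; clear; lra.
have := phi_true _ _ n0 gs; rewrite /sigma => phig.
have {}phig : phi g <= b by apply: phig => i ni; rewrite ltnNge ni.
move: phig.
have := steady_ge _ gk; move: gy; rewrite raddfN /=.
by move: (g (y k)) (phi g) r0 ab => gy pg; clear; lra.
Qed.

End baire.

(** * Weak* convergence *)

Section weak_star_sequences.
Context (R : realType) (X : completeNormedModType R).
Implicit Types (f g h : dual X) (C : set (dual X)) (D : nat -> set (dual X)).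

Lemma ball_dual_osc_le D M : D 0%N `<=` ball_dual M -> osc_le D (`|M| + `|M|).
Proof.
move=> DM.
  move=> x x1; exists 0%N => g h /DM/(_ x) gM /DM/(_ x) hM.
  have Mx : M * `|x| <= `|M|.
    rewrite (@le_trans _ _ (`|M| * `|x|))//.
      by rewrite ler_wpM2r// ler_norm.
    by rewrite ler_piMr.
  have := le_trans gM Mx; have := le_trans hM Mx; rewrite !ler_norml.
  by move: (g x) (h x) `|M| => gx hx m; clear => /andP[h1 h2] /andP[h3 h4]; lra.
Qed.

(** A positive infimum [d] would yield independent half-spaces; by density, the ultrafilter limit of
    their points is the limit of a sequence of [X], which [independent_not_baire1] excludes. *)
Lemma stable_osc_eq0 D M : weak_star_seq_dense_in_bidual X ->
  nest D -> stable D -> D 0%N `<=` ball_dual M ->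
  forall e, 0 < e -> osc_le D e.
Proof.
move=> X_dense nD sD DM.
have DM2 := ball_dual_osc_le DM.
pose E := [set e | osc_le D e]; pose d := inf E.
have Ei : has_inf E.
  by split; [exists (`|M| + `|M|)|exists 0 => e; exact: osc_le_ge0].
have Dd e : d < e -> osc_le D e.
  move=> /inf_lt-/(_ Ei.1)[e' De' e'e]; exact: osc_leW (ltW e'e) De'.
have [d0|d0] := ltP 0 d; last first.
  by move=> e e0; apply: Dd; exact: le_lt_trans e0.
have dD e : e < d -> ~ osc_le D e.
  by move=> ed De; move: ed; rewrite ltNge ge_inf//; case: Ei.
have [s gap indep] := independent_sequence_ex nD sD d0 Dd dD.
have {}indep : independent (ball_dual M) s.
  by move=> sigma n; have [g Dg gs] := indep sigma n; exists g => //; exact: DM.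
have [U [UU oU]] := ultraFilterLemma (F := \oo) _.
have [phi phiE] : exists phi : dual (dual X),
    forall g, g (s n).1.1 @[n --> U] --> phi g.
  have bM n g : `|bidual_embed (s n).1.1 g| <= 1 * `|g|.
    by rewrite mul1r; exact: (@dual_norm_ball _ _ g _ (gap n).1).
  have [phi phiE] := @dual_ultra_cvg R (dual X) U UU
    (fun n => bidual_embed (s n).1.1) 1 bM.
  by exists phi => g; exact: phiE.
have [z [zX /weak_star_cvgP zphi]] : S1 (range (@bidual_embed R X)) phi.
  by rewrite X_dense.
have /choice[y yz] n : exists y : X, bidual_embed y = z n.
  by have [y _ yz] := zX n; exists y.
have yphi g : g (y n) @[n --> \oo] --> phi g.
  by have := zphi g; under eq_fun do rewrite -yz.
by have := independent_not_baire1 UU oU d0 indep gap phiE yphi.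
Qed.

(** In a stable sub-nest the oscillation vanishes, so any selection is pointwise Cauchy and
    converges to its ultrafilter limit. *)
Lemma nest_weak_star_cvg D M : weak_star_seq_dense_in_bidual X ->
  nest D -> D 0%N `<=` ball_dual M ->
  exists (u : nat -> dual X) g, (forall n, D n (u n)) /\ weak_star_cvg u g.
Proof.
move=> X_dense nD DM.
have [D' [nD' D'D sD']] := stable_nest_ex nD (ball_dual_osc_le DM).
have D'M : D' 0%N `<=` ball_dual M by exact: subset_trans (D'D _) DM.
have D'0 := stable_osc_eq0 X_dense nD' sD' D'M.
have /choice[u Du] (n : nat) : exists g, D' n g.
  by have [D'0n _ _] := nD'; exact: D'0n.
have uM n : ball_dual M (u n).
  by apply: D'M; exact: nest_sub (leq0n n) _ (Du n).
have [U [UU oU]] := ultraFilterLemma (F := \oo) _.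
have [g ug] := dual_ultra_cvg UU uM.
exists u, g; split=> [n|]; first exact: D'D.
apply/weak_star_cvgP => x; apply/cvgrPdist_le => e e0.
(* Rescaling by [c] puts [x] in the unit ball, even when [x = 0]. *)
pose c := `|x| + 1.
have c0 : 0 < c by rewrite ltr_wpDl.
have [||N DN] := D'0 (e / c) _ (c^-1 *: x).
- by rewrite divr_gt0.
- by rewrite normrZ gtr0_norm ?invr_gt0// ler_pdivrMl// mulr1 lerDl.
have {}DN n m : (N <= n)%N -> (N <= m)%N -> u n x - u m x <= e.
  move=> Nn Nm; have := DN _ _ (nest_sub nD' Nn (Du n)) (nest_sub nD' Nm (Du m)).
  have uZ k : u k (c^-1 *: x) = c^-1 * u k x by rewrite linearZ.
  by rewrite !uZ -mulrBr ler_pdivrMl// mulrCA mulfV ?gt_eqF// mulr1.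
have gle n : (N <= n)%N -> g x <= u n x + e.
  move=> Nn; apply: (cvgr_to_le (ug x)); apply: oU; exists N => // m /= Nm.
  by rewrite -lerBlDl; exact: DN.
have gge n : (N <= n)%N -> u n x - e <= g x.
  move=> Nn; apply: (cvgr_to_ge (ug x)); apply: oU; exists N => // m /= Nm.
  by rewrite lerBlDr -lerBlDl; exact: DN.
exists N => // n /= Nn; have := gle n Nn; have := gge n Nn; rewrite ler_norml.
by move: (g x) (u n x) => gx ux; clear => *; apply/andP; split; lra.
Qed.

Lemma weak_star_closure_approx C f (x : nat -> X) n (e : R) :
  weak_star_closure C f -> 0 < e ->
  exists2 g, C g & forall i, (i < n)%N -> `|g (x i) - f (x i)| <= e.
Proof.
move=> Cf e0.
have evc z : g z @[g --> (f : weak_star X)] --> f z.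
  pose ev (g : weak_star X) : {ptws X -> R^o} := (g : dual X).
  have FF : Filter (nbhs (f : weak_star X)) by exact: nbhs_filter.
  have h : fmap ev (nbhs (f : weak_star X)) --> ev f.
    exact: (@initial_continuous _ _ ev).
  have := (pointwise_cvgP (ev f) (fmap_filter ev FF)).1 h z.
  by [].
have nf : nbhs (f : weak_star X)
    [set g | forall i, (i < n)%N -> `|g (x i) - f (x i)| <= e].
  elim: n => [|n IHn]; first exact: filterE.
  have /cvgrPdist_le /(_ _ e0) := evc (x n).
  apply: filterS2 IHn => g gn gxn i; rewrite ltnS leq_eqVlt => /predU1P[->|/gn//].
  by rewrite distrC.
by have [g [Cg gn]] := Cf _ nf; exists g.
Qed.

Lemma S1_sub_weak_star_closure C : S1 C `<=` weak_star_closure C.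
Proof.
move=> f [u [Cu uf]] B nB; have [N _ NB] := uf _ nB.
by exists (u N); split; [exact: Cu|exact: (NB N (leqnn N))].
Qed.

Lemma weak_star_closureK C :
  weak_star_closure (weak_star_closure C) = weak_star_closure C.
Proof.
exact: esym ((closure_id _).1 (@closed_closure (weak_star X) C)).
Qed.

Lemma weak_star_closureS C C' : C `<=` C' ->
  weak_star_closure C `<=` weak_star_closure C'.
Proof. exact: (@closure_subset (weak_star X)). Qed.

Lemma sub_S1 C : C `<=` S1 C.
Proof.
move=> f Cf; exists (fun=> f); split=> //.
by apply/weak_star_cvgP => x; exact: cvg_cst.
Qed.

Lemma S1_convex C : convex_set C -> convex_set (S1 C).
Proof.
move=> /convex_setP cC; apply/convex_setP => f g t [u [Cu uf]] [v [Cv vg]] t0 t1.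
exists (fun n => t *: u n + (1 - t) *: v n); split=> [n|]; first exact: cC.
move/weak_star_cvgP in uf; move/weak_star_cvgP in vg.
apply/weak_star_cvgP => x.
have h : t * u n x + (1 - t) * v n x @[n --> \oo] --> t * f x + (1 - t) * g x.
  apply: cvgD; apply: cvgM;
    [exact: cvg_cst|exact: uf|exact: cvg_cst|exact: vg].
exact: h.
Qed.

Lemma closure_sub_S1 C : closure C `<=` S1 C.
Proof.
move=> f Cf.
have /choice[u uP] (n : nat) : exists g, C g /\ `|f - g| <= n.+1%:R^-1.
  have [|g [Cg fg]] := Cf (ball f n.+1%:R^-1).
    by apply: nbhsx_ballx; rewrite invr_gt0.
  by exists g; split=> //; move: fg; rewrite -ball_normE => /ltW.
exists u; split=> [n|]; first by have [] := uP n.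
apply/weak_star_cvgP => x; apply/cvgrPdist_le => e e0.
have c0 : 0 < `|x| + 1 by rewrite ltr_wpDl.
exists (Num.truncn ((`|x| + 1) / e)) => // n /= en.
have : `|f x - u n x| <= `|f - u n| * `|x| by exact: dual_norm_bound (f - u n) x.
move=> /le_trans; apply.
have [_ fu] := uP n; apply: (le_trans (ler_wpM2r (normr_ge0 x) fu)).
rewrite ler_pdivrMl// (@le_trans _ _ (`|x| + 1))// ?lerDl//.
rewrite -ler_pdivrMr// ltW// (lt_le_trans (truncnS_gt _))//.
by rewrite ler_nat ltnS.
Qed.

Lemma bounded_set_ball_dual C : bounded_set C -> exists M, C `<=` ball_dual M.
Proof.
move=> [M [Mreal CM]]; exists (M + 1) => f Cf x.
apply: (le_trans (dual_norm_bound f x)); rewrite ler_wpM2r//.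
by apply: (CM (M + 1)) => //; rewrite ltrDl.
Qed.

Lemma weak_star_closure_sub C : weak_star_seq_dense_in_bidual X ->
  convex_set C -> bounded_set C -> weak_star_closure C `<=` closure (S1 C).
Proof.
move=> X_dense cC /bounded_set_ball_dual[M CM] f Cf; apply: contrapT => nCf.
have [r r0 fr] : exists2 r, 0 < r & forall g, S1 C g -> r <= `|f - g|.
  apply: contrapT => nr; apply: nCf => B /nbhs_ballP[r /= r0 rB].
  apply: contrapT => nCB; apply: nr; exists r => // g Cg.
  rewrite leNgt; apply/negP => fg; apply: nCB; exists g; split=> //.
  by apply: rB; rewrite -ball_normE.
have [phi phir] := convex_separation (S1_convex cC) fr.
have [z [zX /weak_star_cvgP zphi]] : S1 (range (@bidual_embed R X)) phi.
  by rewrite X_dense.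
have /choice[x xz] n : exists x : X, bidual_embed x = z n.
  by have [x _ xz] := zX n; exists x.
have xphi g : g (x n) @[n --> \oo] --> phi g.
  by have := zphi g; under eq_fun do rewrite -xz.
(* Each point [x i] is controlled from level [i.+1] on with tolerance tending to 0, which forces the
   limit [g] to agree with [f] there. *)
pose D n := C `&`
  [set g | forall i, (i < n)%N -> `|g (x i) - f (x i)| <= n.+1%:R^-1].
have nD : nest D.
  split=> n.
  - have [|g Cg gf] := @weak_star_closure_approx C f x n n.+1%:R^-1 Cf.
      by rewrite invr_gt0.
    by exists g.
  - apply/convex_setP => g h t [Cg gf] [Ch hf] t0 t1; split.
      by have /convex_setP := cC; apply.
    move=> i iN; have := gf i iN; have := hf i iN.
    have -> : (t *: g + (1 - t) *: h) (x i) - f (x i) =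
        t * (g (x i) - f (x i)) + (1 - t) * (h (x i) - f (x i)).
      rewrite -[(t *: g + _) _]/(t * g (x i) + (1 - t) * h (x i)).
      by ring.
    move=> hi gi; apply: (le_trans (ler_normD _ _)).
    rewrite -subr_ge0 in t1; rewrite !normrM (ger0_norm t0) (ger0_norm t1).
    have := lerD (ler_wpM2l t0 gi) (ler_wpM2l t1 hi).
    by rewrite -mulrDl [t + _]addrC subrK mul1r.
  - move=> g [Cg gf]; split=> // i iN; apply: (le_trans (gf i _)).
      exact: leq_trans iN (leqnSn n).
    by rewrite lef_pV2 ?posrE// ler_nat.
have DM : D 0%N `<=` ball_dual M by move=> g [Cg _]; exact: CM.
have [u [g [Du ug]]] := nest_weak_star_cvg X_dense nD DM.
have Cg : S1 C g by exists u; split=> // n; have [] := Du n.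
have limU (v : nat -> R^o) (a b : R^o) :
    v @ \oo --> a -> v @ \oo --> b -> a = b.
  by move=> va vb; rewrite -(cvg_lim _ va)// -(cvg_lim _ vb).
have gf i : g (x i) = f (x i).
  have /weak_star_cvgP/(_ (x i)) ugx := ug.
  apply: (limU _ _ _ ugx).
  apply/cvgrPdist_le => e e0.
  exists (maxn i.+1 (Num.truncn e^-1)) => // n /=; rewrite geq_max => /andP[iN nN].
  rewrite distrC (le_trans ((Du n).2 i iN))// invf_ple ?posrE//.
  by rewrite ltW// (lt_le_trans (truncnS_gt _))// ler_nat ltnS.
have phigf : phi g = phi f.
  apply: (limU _ _ _ (xphi g)).
  by under eq_fun do rewrite gf; exact: xphi.
by have := phir g Cg; rewrite phigf gerDl leNgt r0.
Qed.

Lemma S1_S1_sub C : S1 (S1 C) `<=` weak_star_closure C.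
Proof.
apply: (subset_trans (@S1_sub_weak_star_closure _)).
rewrite -[X in _ `<=` X]weak_star_closureK; apply: weak_star_closureS.
exact: S1_sub_weak_star_closure.
Qed.

(** By transfinite induction: the weak* closure is itself closed under weak* limits of sequences. *)
Lemma S_alpha_sub C a : S_alpha C a `<=` weak_star_closure C.
Proof.
elim/(well_founded_induction ord_lt_wf): a => a IHa f; rewrite S_alphaE.
move=> [[_ Cf]|[b [ba [_ Sf]]]|[_ [b [ba Sf]]]].
- exact/S1_sub_weak_star_closure/sub_S1.
- rewrite -weak_star_closureK; apply: S1_sub_weak_star_closure.
  have [u [Su uf]] := Sf; exists u; split=> // n; exact: IHa (Su n).
- exact: IHa Sf.
Qed.

End weak_star_sequences.

(** * Closures, derived sets and the three properties *)

Theorem theorem5p3 (R : realType) (X : completeNormedModType R)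
    (X_dense : weak_star_seq_dense_in_bidual X) :
  [/\ forall C : set (dual X), convex_set C -> bounded_set C ->
        weak_star_closure C = closure (S1 C) /\
        closure (S1 C) = S_alpha C (ord_of_nat 2),
      propertyE' X
    & propertyE X <-> propertyP X].
Proof.
have main (C : set (dual X)) : convex_set C -> bounded_set C ->
    weak_star_closure C = closure (S1 C) /\
    closure (S1 C) = S_alpha C (ord_of_nat 2).
  (* The inclusions run in a circle: weak* closure, norm closure of [S1 C], [S1 (S1 C)], weak*
     closure. *)
  move=> cC bC; have wC := weak_star_closure_sub X_dense cC bC.
  have CS := @closure_sub_S1 _ _ (S1 C).
  rewrite S_two; split; apply/seteqP; split => //.
    exact: subset_trans CS (@S1_S1_sub _ _ _).
  exact: subset_trans (@S1_S1_sub _ _ _) wC.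
split=> //.
- move=> C cC bC; apply/seteqP; split; first exact: S_alpha_sub.
  have [-> ->] := main C cC bC; rewrite (S_limit _ omega1_limit).
  by move=> f Sf; exists (ord_of_nat 2) => //; exact: ord_of_nat_lt.
(* Since the weak* closure is the norm closure of [S1 C], both properties say that [S1 C] is norm
   closed. *)
- split=> [pE C cC bC|pP C cC bC]; have [wC _] := main C cC bC.
    by rewrite pE// wC; exact: closed_closure.
  by rewrite wC; exact/closure_id/pP.
Qed.
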